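(* Let $n\ge 1$ and $1\le m\le n$ be integers, let $D(n)=\{-1,+1\}^n$, and let $L_1=\{\alpha\in\{0,1\}^n : 1\le \sum_{i=1}^n\alpha_i\le m\}$. Let $$O=\Big\{R: D(n)\to\mathbb{Z}_{\ge 0} \;:\; \sum_{a\in D(n)} R(a)\prod_{i=1}^n a_i^{\alpha_i}=0 \ \text{ for all } \alpha\in L_1\Big\}.$$ Then a function $R:D(n)\to\mathbb{Z}_{\ge 0}$ is the counting function of an element of $\mathrm{OA}(n,m)$ if and only if $R\in O$. Moreover, there is a finite set $\{r_1,\dots,r_l\}\subset O$ (a Hilbert basis of $O$) such that the counting functions of the elements of $\mathrm{OA}(n,m)$ are exactly the functions of the form $\sum_{i=1}^l n_i r_i$ with $n_1,\dots,n_l\in\mathbb{Z}_{\ge 0}$.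
   Context: A fraction $F$ of $D(n)=\{-1,+1\}^n$ is a multi-subset of $D(n)$. Its counting function is the function $R:D(n)\to\mathbb{Z}_{\ge0}$ that gives the number of replications $R(a)$ of each point $a\in D(n)$ in $F$; it determines $F$. No restriction is placed on the total number of points or on the number of replications, and the empty fraction (counting function $0$) is allowed. For $J\subset\{1,\dots,n\}$, the projection of $F$ on the factors with indices in $J$ is the multi-subset of $\{-1,+1\}^J$ with counting function $R_J(a_J)=\sum_{b\in\{-1,+1\}^{J^c}} R(a_J,b)$. A replication of the full factorial design $\{-1,+1\}^J$ is a multi-subset of $\{-1,+1\}^J$ whose counting function is constant. $\mathrm{OA}(n,m)$, the set of $n$-dimensional (2-level) orthogonal arrays of force $m$, is the set of fractions $F$ of $D(n)$ such that for every $J\subset\{1,\dots,n\}$ with $|J|=m$, the projection of $F$ on the factors in $J$ is a replication of the full factorial design $\{-1,+1\}^J$. A Hilbert basis of a semigroup $O$ of lattice points is a finite set of elements of $O$ such that every element of $O$ is a linear combination of them with non-negative integer coefficients. *)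

(* Defs.v *)
From mathcomp Require Import all_boot all_order all_algebra.
From mathcomp Require Import finmap multiset.

Set Implicit Arguments.
Unset Strict Implicit.
Unset Printing Implicit Defensive.

Import GRing.Theory.
Local Open Scope ring_scope.
Local Open Scope fset_scope.
Local Open Scope mset_scope.

(* The set {-1,+1} of factor levels, as a finite subtype of int. *)
Definition level : Type := seq_sub [:: (-1 : int); 1].

Definition level_int (x : level) : int := ssval x.
Coercion level_int : level >-> int.

Definition D (n : nat) : Type := {ffun 'I_n -> level}.

Definition subD (n : nat) (J : {set 'I_n}) : Type :=
  {ffun {i : 'I_n | i \in J} -> level}.

Lemma in_or_in_setC (n : nat) (J : {set 'I_n}) (i : 'I_n) :
  {i \in J} + {i \in ~: J}.
Proof. by case: (boolP (i \in J)) => iJ; [left | right; rewrite in_setC]. Qed.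

(* The point (a_J, b) of D(n) with J-coordinates a_J and J^c-coordinates b. *)
Definition glue (n : nat) (J : {set 'I_n}) (aJ : subD J) (b : subD (~: J)) :
    D n :=
  [ffun i => match in_or_in_setC J i with
             | left iJ => aJ (exist _ i iJ)
             | right iJc => b (exist _ i iJc)
             end].

Definition fraction (n : nat) : Type := {mset D n}.

Definition counting (n : nat) (F : fraction n) : {ffun D n -> nat} :=
  [ffun a => (F : {mset D n}) a].

Definition projection (n : nat) (F : fraction n) (J : {set 'I_n}) :
    {mset subD J} :=
  [fsfun aJ in [fset x in {: subD J}] =>
     (\sum_(b : subD (~: J)) counting F (glue aJ b))%N | 0%N].

Definition full_factorial_replication (n : nat) (J : {set 'I_n})
    (G : {mset subD J}) : Prop :=
  exists k : nat, forall aJ : subD J, G aJ = k.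

Definition OA (n m : nat) (F : fraction n) : Prop :=
  forall J : {set 'I_n}, #|J| = m ->
    full_factorial_replication (projection F J).

Definition L1 (n m : nat) : {set {ffun 'I_n -> 'I_2}} :=
  [set alpha : {ffun 'I_n -> 'I_2} | (1 <= \sum_(i < n) alpha i <= m)%N].

Definition semigroupO (n m : nat) (R : {ffun D n -> nat}) : Prop :=
  forall alpha, alpha \in L1 n m ->
    \sum_(a : D n) (R a)%:Z * \prod_(i < n) (a i : int) ^+ alpha i = 0.

(* A generating set by non-negative integer combinations; no minimality is
   required. *)
Definition hilbert_basis (V : nmodType) (S : V -> Prop) (B : {fset V}) : Prop :=
  (forall r, r \in B -> S r) /\
  (forall x, S x -> exists k : V -> nat, x = \sum_(r <- B) r *+ k r).

(* Main.v *)
(** The moment conditions say that [R] is orthogonal to the characters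
    [a |-> \prod_(i in K) a_i] with [1 <= #|K| <= m].  A uniform projection on [J]
    kills every nontrivial character supported in [J]; conversely the indicator of
    [a_J = c] is, up to the factor [2 ^ m], the sum of the characters supported in
    [J] with signs, so only the trivial one contributes to [R_J(c)], which is then
    independent of [c].  The semigroup [O] is closed under subtraction whenever the
    difference is nonnegative, so a finite dominating set of its nonzero elements,
    given by Dickson's lemma, generates it by descent on the total mass. *)

Require Import Defs.
From mathcomp Require Import all_boot all_order all_algebra.
From mathcomp Require Import finmap multiset.
From Stdlib Require Import Classical.
Import GRing.Theory.
Local Open Scope ring_scope.
Local Open Scope fset_scope.

(** * Dickson's lemma and finite generation *)

Section Dickson.

Local Open Scope ring_scope.

Context {I : finType}.
Local Notation V := {ffun I -> nat}.

(* Dickson's lemma, by induction on the list of coordinates to be compared: if [B]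
   works for [s] and [T] bounds the [i]-th coordinates of [B], then [B] also works
   for [i :: s] on the elements with [x i >= T]; only the finitely many slices
   [x i = t < T] remain. *)
Lemma dickson_coords (s : seq I) (S : V -> Prop) :
  exists2 B : seq V, {in B, forall b, S b} &
    forall x, S x -> exists2 b, b \in B & {in s, forall i, b i <= x i}%N.
Proof.
elim: s S => [|i s IHs] S.
  have [[x Sx]|noS] := classic (exists x, S x).
    by exists [:: x] => [b|y _]; [rewrite inE => /eqP->|exists x; rewrite ?mem_head].
  by exists [::] => // x Sx; case: noS; exists x.
have [B0 B0S B0P] := IHs S.
pose T := \max_(b <- B0) b i.
have [B1 B1S B1P] : exists2 B : seq V, {in B, forall b, S b} &
    forall x, S x -> (x i < T)%N ->
      exists2 b, b \in B & {in i :: s, forall j, b j <= x j}%N.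
  elim: T => [|t [B BS BP]]; first by exists [::].
  have [C CS CP] := IHs (fun x => S x /\ x i = t).
  exists (C ++ B) => [b|x Sx].
    by rewrite mem_cat => /orP[/CS[]|/BS].
  rewrite ltnS leq_eqVlt => /orP[/eqP xt|/(BP _ Sx)[b bB bx]]; last first.
    by exists b; rewrite // mem_cat bB orbT.
  have [b bC bx] := CP x (conj Sx xt).
  exists b => [|j]; first by rewrite mem_cat bC.
  rewrite inE => /predU1P[->|/bx//].
  by rewrite (CS b bC).2 xt.
exists (B0 ++ B1) => [b|x Sx]; first by rewrite mem_cat => /orP[/B0S|/B1S].
have [xT|Tx] := ltnP (x i) T.
  by have [b bB bx] := B1P x Sx xT; exists b; rewrite // mem_cat bB orbT.
have [b bB bx] := B0P x Sx.
exists b => [|j]; first by rewrite mem_cat bB.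
rewrite inE => /predU1P[->|/bx//].
by apply: leq_trans Tx; rewrite /T (big_rem b bB) leq_max leqnn.
Qed.

Lemma ffun_nat_subK (b x : V) : (forall i, b i <= x i)%N ->
  x = b + [ffun i => (x i - b i)%N].
Proof. by move=> bx; apply/ffunP=> i; rewrite !ffunE -[RHS]/(b i + _)%N subnKC. Qed.

Lemma hilbert_basis_exists (S : V -> Prop) :
  (forall x y, S x -> S (x + y) -> S y) -> exists B, hilbert_basis S B.
Proof.
move=> Ssub.
(* Zero is excluded so that subtracting an element of [B] strictly lowers the total mass; [x = 0] is
   the empty combination. *)
have [B BS BP] := dickson_coords (enum I) (fun x => S x /\ x != 0).
exists [fset b in B]; split=> [r|x]; first by rewrite inE => /BS[].
have [d] := ubnP (\sum_i x i)%N; elim: d x => // d IHd x; rewrite ltnS => xd Sx.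
have [->|x0] := eqVneq x 0.
  by exists (fun=> 0%N); rewrite big1.
have [b bB bx] := BP x (conj Sx x0).
have {bx}/ffun_nat_subK def_x : forall i, (b i <= x i)%N.
  by move=> i; apply: bx; rewrite mem_enum.
set y := [ffun i => _] in def_x.
have [Sb b0] := BS b bB.
have Sy : S y by apply: (Ssub b) => //; rewrite -def_x.
have yd : (\sum_i y i < d)%N.
  apply: leq_trans xd; rewrite def_x.
  under [X in (_ < X)%N]eq_bigr => i _ do rewrite [(b + y) i]ffunE -[b i + y i]/(b i + y i)%N.
  rewrite big_split /= -[X in (X < _)%N]add0n ltn_add2r lt0n.
  apply: contra b0 => /eqP sb0; apply/eqP/ffunP=> i; rewrite ffunE.
  by apply/eqP; rewrite -[_ == _]leqn0 -[X in (_ <= X)%N]sb0 (bigD1 i) //= leq_addr.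
have [k def_y] := IHd y yd Sy.
(* The indicator of [b] accounts for the one copy of [b] that was subtracted. *)
exists (fun r => ((r == b) + k r)%N); rewrite {1}def_x {1}def_y.
under [RHS]eq_bigr => r _ do rewrite mulrnDr.
rewrite big_split /=; congr (_ + _).
have bB' : b \in [fset b in B] by rewrite inE.
by rewrite (big_fsetD1 b) //= eqxx big1_fset ?addr0 // => r; rewrite !inE => /andP[/negPf->].
Qed.

End Dickson.

(** * Characters of one factor *)

Section Level.

Local Open Scope ring_scope.

Lemma prod_addr1 (A : comPzRingType) (I : finType) (f : I -> A) :
  \prod_i (f i + 1) = \sum_(K : {set I}) \prod_(i in K) f i.
Proof.
rewrite (bigA_distr _ _ f (fun=> 1)).
by apply: eq_bigr => K _; rewrite -big_mkcond.
Qed.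

Lemma level_intP (x : level) : x = -1 :> int \/ x = 1 :> int.
Proof.
by have := ssvalP x; rewrite !inE /level_int => /orP[/eqP->|/eqP->]; [left|right].
Qed.

Lemma level_int_inj : injective level_int.
Proof. exact: val_inj. Qed.

(** Multiplied over coordinates, this makes the indicator of a point, up to a power of 2, a
    polynomial in the levels. *)
Lemma addr1_level_mul (x y : level) : 1 + (x : int) * y = (x == y)%:R *+ 2.
Proof.
rewrite -(inj_eq level_int_inj).
by have [->|->] := level_intP x; have [->|->] := level_intP y.
Qed.

Lemma sum_level : \sum_(x : level) (x : int) = 0.
Proof.
have m1 : -1 \in [:: (-1 : int); 1] by [].
have p1 : 1 \in [:: (-1 : int); 1] by [].
rewrite (bigD1 (SeqSub m1 : level)) //= (bigD1 (SeqSub p1 : level)) //= big1 // => x.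
rewrite -!(inj_eq level_int_inj) /=.
by have [->|->] := level_intP x.
Qed.

End Level.

(** * Uniform projections and vanishing moments *)

Section Projection.

Local Open Scope ring_scope.

Context {n : nat}.
Implicit Types (J : {set 'I_n}) (R : {ffun D n -> nat}) (F : fraction n).

Definition restr J (a : D n) : subD J := [ffun j => a (val j)].

Lemma restr_glue J (aJ : subD J) (b : subD (~: J)) : restr J (glue aJ b) = aJ.
Proof.
apply/ffunP=> -[i iJ]; rewrite !ffunE /=; case: in_or_in_setC => iJ'.
  by congr (aJ _); apply: val_inj.
by have := iJ'; rewrite inE iJ.
Qed.

Lemma restrC_glue J (aJ : subD J) (b : subD (~: J)) : restr (~: J) (glue aJ b) = b.
Proof.
apply/ffunP=> -[i iJ]; rewrite !ffunE /=; case: in_or_in_setC => iJ'.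
  by have := iJ; rewrite inE iJ'.
by congr (b _); apply: val_inj.
Qed.

Lemma glue_restr J (a : D n) : glue (restr J a) (restr (~: J) a) = a.
Proof.
by apply/ffunP=> i; rewrite !ffunE; case: in_or_in_setC => iJ; rewrite !ffunE.
Qed.

Lemma projectionE F J (aJ : subD J) :
  projection F J aJ = (\sum_(a : D n | restr J a == aJ) counting F a)%N.
Proof.
rewrite fsfunE !inE /=.
rewrite (reindex_onto (glue aJ) (restr (~: J))) /=; last first.
  by move=> a /eqP <-; rewrite glue_restr.
by apply: eq_bigl => b; rewrite restr_glue restrC_glue !eqxx.
Qed.

Definition mset_of_counting R : fraction n := [fsfun a in [fset a in {: D n}] => R a | 0%N].

Lemma mset_of_countingK R : counting (mset_of_counting R) = R.
Proof. by apply/ffunP=> a; rewrite ffunE fsfunE !inE. Qed.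

Lemma semigroupO_OA m F : semigroupO m (counting F) -> OA m F.
Proof.
move=> OF J cJ.
have point : subD J by apply: (restr J); apply: [ffun=> SeqSub (mem_head _ _)].
(* The right-hand side does not involve [aJ], and multiplication by [2 ^ m] is injective on
   integers, so every count equals the one at [point]. *)
suff key (aJ : subD J) : ((projection F J aJ)%:Z *+ 2 ^ m = \sum_a (counting F a)%:Z)%R.
  exists (projection F J point) => aJ; have := etrans (key aJ) (esym (key point)).
  by move/(@Num.Theory.pmulrnI _ _ (expn_gt0 2 m)) => [].
rewrite projectionE -natz natr_sum big_mkcond /= -sumrMnl.
have cJ' : #|{: {i : 'I_n | i \in J}}| = m by rewrite card_sig -cJ.
(* [\prod_(j in J) (a_j * aJ_j + 1)] is [2 ^ m] times the indicator of
   [restr J a = aJ]; on expanding it, every monomial but [1] sums to 0 against [counting F]. *)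
transitivity (\sum_(a : D n) (counting F a)%:Z *
    \prod_(j : {i | i \in J}) (level_int (a (val j)) * aJ j + 1)).
  apply: eq_bigr => a _.
  under eq_bigr => j _ do rewrite addrC addr1_level_mul.
  rewrite prodrMn_const cJ' mulrnAr; congr (_ *+ _).
  case: eqP => [<-|ne].
    by rewrite big1 ?mulr1 ?natz // => j _; rewrite ffunE eqxx.
  have [j] : exists j, restr J a j != aJ j.
    apply/existsP; rewrite -negb_forall; apply/negP=> /forallP eqa.
    by apply: ne; apply/ffunP=> j; apply/eqP.
  by rewrite ffunE (bigD1 j) //= => /negPf->; rewrite mul0r mulr0.
under [LHS]eq_bigr => a _ do rewrite prod_addr1 mulr_sumr.
rewrite exchange_big /= (bigD1 set0) //= [X in _ + X]big1 ?addr0 => [|K K0].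
  by apply: eq_bigr => a _; rewrite big1 ?mulr1 // => j; rewrite inE.
(* Exponent vector of the monomial indexed by [K]; its weight [#|K|] is positive as [K] is nonempty,
   and at most [#|J| = m]. *)
pose alpha : {ffun 'I_n -> 'I_2} := [ffun i => inord (i \in val @: K)].
have alphaE i : alpha i = (i \in val @: K) :> nat.
  by rewrite ffunE inordK //; case: (_ \in _).
have alphaL1 : alpha \in L1 n m.
  rewrite inE; under eq_bigr => i _ do rewrite alphaE.
  have -> : (\sum_i (i \in val @: K) = #|K|)%N.
    rewrite -(card_imset _ val_inj) -sum1_card [RHS]big_mkcond.
    by apply: eq_bigr => i _; case: ifP.
  by rewrite card_gt0 K0 -cJ' max_card.
(* The sign coming from [aJ] does not depend on [a], so it factors out of the vanishing moment. *)
rewrite -[RHS](mulr0 (\prod_(j in K) level_int (aJ j))) -[in RHS](OF _ alphaL1) mulr_sumr.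
apply: eq_bigr => a _; rewrite mulrCA; congr (_ * _).
rewrite big_split mulrC /=; congr (_ * _).
rewrite -(big_imset (fun i => level_int (a i))) => [|i j _ _ /val_inj//].
rewrite big_mkcond; apply: eq_bigr => i _.
by rewrite alphaE; case: ifP.
Qed.

(** [OA] only constrains sets of size exactly [m], so a smaller support of an exponent vector must
    first be enlarged. *)
Lemma superset_card {T : finType} (A : {set T}) k : (#|A| <= k <= #|T|)%N ->
  exists2 B : {set T}, A \subset B & #|B| = k.
Proof.
elim: k => [|k IHk] /andP[]; first by exists A => //; apply/eqP; rewrite -leqn0.
rewrite leq_eqVlt => /predU1P[cA _|]; first by exists A.
rewrite ltnS => Ak kT.
have [|B AB cB] := IHk; first by rewrite Ak ltnW.
have : (0 < #|~: B|)%N by rewrite cardsCs setCK subn_gt0 cB.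
rewrite card_gt0 => /set0Pn[x]; rewrite inE => xB.
exists (x |: B); last by rewrite cardsU1 xB cB.
exact: subset_trans (subsetUr _ _).
Qed.

Lemma OA_semigroupO m F : (m <= n)%N -> OA m F -> semigroupO m (counting F).
Proof.
move=> mn OF alpha; rewrite inE => /andP[alpha_gt0 alpha_le].
pose A := [set i | alpha i != 0 :> nat].
have [|J AJ cJ] := @superset_card _ A m.
  rewrite card_ord mn andbT; apply: leq_trans alpha_le.
  rewrite -sum1_card big_mkcond; apply: leq_sum => i _; rewrite inE.
  by case: (nat_of_ord _).
have [k kP] := OF J cJ.
(* The support of [alpha] lies in [J], so the monomial factors through [restr J] and the moment can
   be summed fibre by fibre. *)
pose chi (aJ : subD J) := \prod_(j : {i | i \in J}) level_int (aJ j) ^+ alpha (val j).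
have chiE (a : D n) : \prod_i level_int (a i) ^+ alpha i = chi (restr J a).
  rewrite (bigID (mem J)) /= [X in _ * X]big1 ?mulr1 => [|i iJ]; last first.
    have /eqP-> : alpha i == 0 :> nat; last by rewrite expr0.
    by apply: contraNT iJ => i0; apply: (subsetP AJ); rewrite inE.
  rewrite big_sub.
  by apply: eq_bigr => j _; rewrite ffunE.
transitivity (\sum_(aJ : subD J) k%:Z * chi aJ).
  rewrite (partition_big (restr J) predT) //=; apply: eq_bigr => aJ _.
  rewrite -(kP aJ) projectionE -natz natr_sum mulr_suml.
  by apply: eq_bigr => a /eqP<-; rewrite chiE natz.
(* The sum of [chi] is a product of one-coordinate sums; the factor at any [i] with [alpha i = 1] is
   [-1 + 1 = 0]. *)
rewrite -mulr_sumr -(bigA_distr_bigA (fun j x => level_int x ^+ alpha (val j))).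
have [i iA] : exists i, alpha i != 0 :> nat.
  apply/existsP; rewrite -negb_forall; apply: contraL alpha_gt0 => /forallP a0.
  by rewrite big1 // => i _; apply/eqP.
have iJ : i \in J by apply: (subsetP AJ); rewrite inE.
rewrite (bigD1 (exist _ i iJ)) //=.
have -> : alpha i = 1%N :> nat by case: (alpha i) iA => [[|[]]].
under eq_bigr => x _ do rewrite expr1.
by rewrite sum_level mul0r mulr0.
Qed.

(** Moments are additive in the counting function. The forward direction feeds the descent; the
    backward one keeps combinations of generators in the semigroup. *)
Lemma semigroupO_addl m (x y : {ffun D n -> nat}) :
  semigroupO m x -> semigroupO m (x + y) <-> semigroupO m y.
Proof.
move=> Ox; suff eqxy alpha : alpha \in L1 n m ->
    \sum_(a : D n) ((x + y)%R a)%:Z * \prod_i level_int (a i) ^+ alpha i =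
    \sum_(a : D n) (y a)%:Z * \prod_i level_int (a i) ^+ alpha i.
  by split=> O alpha /[dup] La /O; rewrite eqxy.
move=> /Ox x0; rewrite -[RHS]add0r -[X in _ = X + _]x0 -big_split.
by apply: eq_bigr => a _ /=; rewrite -mulrDl -PoszD ffunE.
Qed.

End Projection.

Theorem mainTheorem1 (n m : nat) (hn : (1 <= n)%N) (hm : (1 <= m <= n)%N) :
  (forall R : {ffun D n -> nat},
     (exists F : fraction n, OA m F /\ counting F = R) <-> semigroupO m R) /\
  (exists B : {fset {ffun D n -> nat}},
     hilbert_basis (@semigroupO n m) B /\
     forall R : {ffun D n -> nat},
       (exists F : fraction n, OA m F /\ counting F = R) <->
       (exists k : {ffun D n -> nat} -> nat,
          R = \sum_(r <- B) r *+ k r)).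
Proof.
have [_ mn] := andP hm.
have OAE R : (exists F : fraction n, OA m F /\ counting F = R) <-> semigroupO m R.
  split=> [[F [OF <-]]|OR]; first exact: OA_semigroupO.
  exists (mset_of_counting R); rewrite mset_of_countingK; split=> //.
  by apply: semigroupO_OA; rewrite mset_of_countingK.
split=> //.
have [B [BO BP]] := @hilbert_basis_exists _ (@semigroupO n m)
  (fun x y Ox => (semigroupO_addl m x y Ox).1).
exists B; split=> // R; rewrite OAE; split=> [/BP//|[k ->]].
rewrite big_seq; apply: big_ind => [|x y Ox Oy|r /BO Or].
- by move=> alpha _; rewrite big1 // => a _; rewrite ffunE mul0r.
- exact/semigroupO_addl.
elim: (k r) => [|d IHd]; last by rewrite mulrS; apply/semigroupO_addl.
by move=> alpha _; rewrite big1 // => a _; rewrite mulr0n ffunE mul0r.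
Qed.
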